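(* Let $x:(I,\frac1m)\to\mathbb{H}$ be a discrete polarised curve, let $\mu\in\mathbb{R}$ with $\mu\neq m_{ij}$ on every edge $(ij)$, and let $\hat x:(I,\frac1m)\to\mathbb{H}$ be a discrete polarised curve with $\hat x_i\ne x_i$ for all $i\in I$. Then $\hat x$ is a Darboux transform of $x$ with spectral parameter $\mu$ if and only if $\hat L=\begin{pmatrix}\hat x\\1\end{pmatrix}\mathbb{H}$ is $(\mathrm{d}^\mu)^P$-parallel.
   Context: $\mathbb{H}$ denotes the quaternions, identified with $\mathbb{R}^4$; $\mathbb{H}^2$ is a right $\mathbb{H}$-vector space. $I$ is a discrete interval (a set of consecutive integers; edges are pairs of consecutive integers). A discrete polarised curve $x:(I,\frac1m)\to\mathbb{H}$ is a map $i\mapsto x_i$ together with a strictly positive or strictly negative real function $m$ on the unoriented edges ($m_{ij}=m_{ji}$), where $x_i\neq x_j$ on every edge $(ij)$ for the curve $x$ being transformed. Write $dx_{ij}:=x_i-x_j$ and $dx^d_{ij}:=\frac{1}{m_{ij}}(dx_{ij})^{-1}$. Darboux pair: $x,\hat x$ are a Darboux pair with spectral parameter $\mu$ ($\hat x$ is a Darboux transform of $x$) if on every edge $(ij)$ $$(x_i-x_j)(x_j-\hat x_j)^{-1}(\hat x_j-\hat x_i)(\hat x_i-x_i)^{-1}=\frac{\mu}{m_{ij}}.$$ Discrete connection: for $\lambda\in\mathbb{R}$ and every oriented edge $(ij)$, define the right-linear map $\mathrm{d}^\lambda_{ji}:\{i\}\times\mathbb{H}^2\to\{j\}\times\mathbb{H}^2$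 by $$\mathrm{d}^\lambda_{ji}=\mathrm{id}+\lambda\begin{pmatrix} x_j\,dx^d_{ij} & -x_j\,dx^d_{ij}\,x_i\\ dx^d_{ij} & -dx^d_{ij}\,x_i\end{pmatrix},$$ and let $(\mathrm{d}^\lambda)^P_{ji}:\{i\}\times\mathbb{HP}^1\to\{j\}\times\mathbb{HP}^1$ be the induced projective map. A section $\hat L$ (an assignment of $\hat L_i\in\mathbb{HP}^1$ to each $i\in I$) is $(\mathrm{d}^\mu)^P$-parallel if $(\mathrm{d}^\mu)^P_{ji}\hat L_i=\hat L_j$ on every oriented edge $(ij)$. *)

(* Defs.v *)
From HB Require Import structures.
From mathcomp Require Import all_boot all_order all_algebra ring.
From mathcomp Require Import boolp classical_sets reals.

Set Implicit Arguments.
Unset Strict Implicit.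
Unset Printing Implicit Defensive.

Import Order.TTheory GRing.Theory Num.Theory.
Local Open Scope classical_set_scope.
Local Open Scope ring_scope.

(* [Quat a b c d] is a + b i + c j + d k, with i^2 = j^2 = k^2 = ijk = -1. *)
Record quat (R : Type) := Quat { qre : R; qi : R; qj : R; qk : R }.

Lemma quatP (R : Type) (p q : quat R) :
  qre p = qre q -> qi p = qi q -> qj p = qj q -> qk p = qk q -> p = q.
Proof. by case: p => a b c d; case: q => a' b' c' d' /= -> -> -> ->. Qed.

Section QuatChoice.
Variable R : choiceType.

Definition quat_tuple (q : quat R) := (qre q, qi q, qj q, qk q).
Definition tuple_quat (t : R * R * R * R) :=
  Quat t.1.1.1 t.1.1.2 t.1.2 t.2.

Lemma quat_tupleK : cancel quat_tuple tuple_quat.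
Proof. by case. Qed.

HB.instance Definition _ := Choice.copy (quat R) (can_type quat_tupleK).
End QuatChoice.

Section QuatAlgebra.
Variable R : realFieldType.
Implicit Types p q : quat R.

Definition quat_zero : quat R := Quat 0 0 0 0.
Definition quat_one : quat R := Quat 1 0 0 0.
Definition quat_opp p : quat R := Quat (- qre p) (- qi p) (- qj p) (- qk p).
Definition quat_add p q : quat R :=
  Quat (qre p + qre q) (qi p + qi q) (qj p + qj q) (qk p + qk q).
Definition quat_mul p q : quat R :=
  Quat (qre p * qre q - qi p * qi q - qj p * qj q - qk p * qk q)
       (qre p * qi q + qi p * qre q + qj p * qk q - qk p * qj q)
       (qre p * qj q - qi p * qk q + qj p * qre q + qk p * qi q)
       (qre p * qk q + qi p * qj q - qj p * qi q + qk p * qre q).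
Definition quat_scale (r : R) q : quat R :=
  Quat (r * qre q) (r * qi q) (r * qj q) (r * qk q).
Definition quat_sqnorm q : R := qre q ^+ 2 + qi q ^+ 2 + qj q ^+ 2 + qk q ^+ 2.
Definition quat_inv q : quat R :=
  quat_scale (quat_sqnorm q)^-1 (Quat (qre q) (- qi q) (- qj q) (- qk q)).

Fact quat_addA : associative quat_add.
Proof. by move=> p q r; apply: quatP => /=; ring. Qed.
Fact quat_addC : commutative quat_add.
Proof. by move=> p q; apply: quatP => /=; ring. Qed.
Fact quat_add0 : left_id quat_zero quat_add.
Proof. by move=> p; apply: quatP => /=; ring. Qed.
Fact quat_addN : left_inverse quat_zero quat_opp quat_add.
Proof. by move=> p; apply: quatP => /=; ring. Qed.

HB.instance Definition _ :=
  GRing.isZmodule.Build (quat R) quat_addA quat_addC quat_add0 quat_addN.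

Fact quat_mulA : associative quat_mul.
Proof. by move=> p q r; apply: quatP => /=; ring. Qed.
Fact quat_mul1 : left_id quat_one quat_mul.
Proof. by move=> p; apply: quatP => /=; ring. Qed.
Fact quat_mulr1 : right_id quat_one quat_mul.
Proof. by move=> p; apply: quatP => /=; ring. Qed.
Fact quat_mulDl : left_distributive quat_mul +%R.
Proof. by move=> p q r; apply: quatP => /=; ring. Qed.
Fact quat_mulDr : right_distributive quat_mul +%R.
Proof. by move=> p q r; apply: quatP => /=; ring. Qed.
Fact quat_1_neq0 : quat_one != 0.
Proof. by apply/eqP => -[] /eqP; rewrite oner_eq0. Qed.

HB.instance Definition _ := GRing.Zmodule_isNzRing.Build (quat R)
  quat_mulA quat_mul1 quat_mulr1 quat_mulDl quat_mulDr quat_1_neq0.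

Fact quat_scaleA a b q : quat_scale a (quat_scale b q) = quat_scale (a * b) q.
Proof. by apply: quatP => /=; ring. Qed.
Fact quat_scale1 : left_id 1 quat_scale.
Proof. by move=> q; apply: quatP => /=; ring. Qed.
Fact quat_scaleDr : right_distributive quat_scale +%R.
Proof. by move=> a p q; apply: quatP => /=; ring. Qed.
Fact quat_scaleDl q : {morph quat_scale^~ q : a b / a + b}.
Proof. by move=> a b; apply: quatP => /=; ring. Qed.

HB.instance Definition _ := GRing.Zmodule_isLmodule.Build R (quat R)
  quat_scaleA quat_scale1 quat_scaleDr quat_scaleDl.

Fact quat_scaleAl (a : R) p q : a *: (p * q) = (a *: p) * q.
Proof. by apply: quatP => /=; ring. Qed.

HB.instance Definition _ :=
  GRing.Lmodule_isLalgebra.Build R (quat R) quat_scaleAl.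

Fact quat_scaleAr (a : R) p q : a *: (p * q) = p * (a *: q).
Proof. by apply: quatP => /=; ring. Qed.

HB.instance Definition _ :=
  GRing.Lalgebra_isAlgebra.Build R (quat R) quat_scaleAr.

Lemma quat_sqnorm_neq0 q : q != 0 -> quat_sqnorm q != 0.
Proof.
apply: contra_neq => /eqP.
rewrite /quat_sqnorm !paddr_eq0 ?addr_ge0 ?sqr_ge0 // !sqrf_eq0.
by move=> /andP[/andP[/andP[/eqP a0 /eqP b0] /eqP c0] /eqP d0]; apply: quatP.
Qed.

Fact quat_mulVr : {in [pred q : quat R | q != 0], left_inverse 1 quat_inv *%R}.
Proof.
move=> q /quat_sqnorm_neq0; rewrite /quat_sqnorm => q0.
by apply: quatP; rewrite /= /quat_sqnorm; field.
Qed.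
Fact quat_mulrV : {in [pred q : quat R | q != 0], right_inverse 1 quat_inv *%R}.
Proof.
move=> q /quat_sqnorm_neq0; rewrite /quat_sqnorm => q0.
by apply: quatP; rewrite /= /quat_sqnorm; field.
Qed.
Fact quat_unitP p q : q * p = 1 /\ p * q = 1 -> p != 0.
Proof.
move=> [qp _]; apply/eqP => p0; move/eqP: qp.
by rewrite p0 mulr0 eq_sym oner_eq0.
Qed.
Fact quat_inv_out : {in [predC [pred q : quat R | q != 0]], quat_inv =1 id}.
Proof.
move=> q; rewrite !inE negbK => /eqP->.
by apply: quatP => /=; ring.
Qed.

HB.instance Definition _ := GRing.NzRing_hasMulInverse.Build (quat R)
  quat_mulVr quat_mulrV quat_unitP quat_inv_out.

Lemma quat_unitE q : (q \is a GRing.unit) = (q != 0).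
Proof. by []. Qed.

End QuatAlgebra.

Section ProjectiveLine.
Variable R : realType.
Local Notation H := (quat R).

(* Vectors of the right H-space H^2 are columns, right scalar multiplication *)
(* by q is [v *m q%:M] with [q%:M : 'M_1], and right-linear endomorphisms    *)
(* are 2 x 2 matrices acting on the left.                                    *)
Definition col2 (p q : H) : 'cV[H]_2 := \col_i (if i == 0 then p else q).

Definition mx2 (a b c d : H) : 'M[H]_2 :=
  \matrix_(i, j) (if i == 0 then (if j == 0 then a else b)
                  else (if j == 0 then c else d)).

Definition hline (v : 'cV[H]_2) : set 'cV[H]_2 := range (fun q : H => v *m q%:M).

Record HP1 := MkHP1 {
  HP1_set :> set 'cV[H]_2;
  HP1_setP : exists2 v : 'cV[H]_2, v != 0 & HP1_set = hline v
}.

Lemma col2_neq0 (p : H) : col2 p 1 != 0.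
Proof.
by apply/eqP => /matrixP/(_ 1 0); rewrite !mxE /= => /eqP; rewrite oner_eq0.
Qed.

Definition affine_pt (p : H) : HP1 :=
  MkHP1 (ex_intro2 _ _ (col2 p 1) (col2_neq0 p) erefl).

(* The projective map induced by A sends the line L to its image A(L). This  *)
(* is again a point of HP^1 when A is injective ([proj_image_HP1] below).    *)
Definition proj_image (A : 'M[H]_2) (L : HP1) : set 'cV[H]_2 := mulmx A @` L.

Lemma proj_image_HP1 (A : 'M[H]_2) (L : HP1) :
  injective (mulmx A : 'cV[H]_2 -> 'cV[H]_2) ->
  exists L' : HP1, proj_image A L = L'.
Proof.
move=> injA; have [v v0 Lv] := HP1_setP L; rewrite /proj_image Lv.
have Av0 : A *m v != 0.
  by apply: contra_neq v0 => Av; apply: injA; rewrite mulmx0.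
exists (MkHP1 (ex_intro2 _ _ (A *m v) Av0 erefl)).
apply/seteqP; split=> w /=.
  by move=> [_ [q _ <-] <-]; exists q; rewrite ?mulmxA.
by move=> [q _ <-]; exists (v *m q%:M); [exists q | rewrite mulmxA].
Qed.

End ProjectiveLine.

(* Every set of consecutive integers, bounded or not, is an [interval int]. *)
Definition vertex (I : interval int) := {i : int | i \in I}.

Definition edge (I : interval int) (i j : vertex I) : bool :=
  (val j == val i + 1) || (val i == val j + 1).

Section PolarisedCurve.
Variables (R : realType) (I : interval int).
Local Notation H := (quat R).
Implicit Types (m : vertex I -> vertex I -> R) (x xh : vertex I -> H).

(* Only the values of [m] on edges are meaningful. *)
Definition polarisation m : Prop :=
  (forall i j, edge i j -> m i j = m j i) /\
  ((forall i j, edge i j -> 0 < m i j) \/ (forall i j, edge i j -> m i j < 0)).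

Definition dx x (i j : vertex I) : H := x i - x j.

Definition dxd m x (i j : vertex I) : H := (m i j)^-1 *: (dx x i j)^-1.

Definition darboux_pair m (mu : R) x xh : Prop :=
  forall i j, edge i j ->
    (x i - x j) * (x j - xh j)^-1 * (xh j - xh i) * (xh i - x i)^-1
    = (mu / m i j)%:A.

(* [dconn m x lambda j i] maps the fibre at i to the fibre at j. *)
Definition dconn m x (lambda : R) (j i : vertex I) : 'M[H]_2 :=
  1%:M + lambda%:A *:
    mx2 (x j * dxd m x i j) (- (x j * dxd m x i j * x i))
        (dxd m x i j)       (- (dxd m x i j * x i)).

Definition proj_parallel m x (lambda : R) (L : vertex I -> HP1 R) : Prop :=
  forall i j, edge i j -> proj_image (dconn m x lambda j i) (L i) = L j.

Lemma dconn_inj m x (lambda : R) (i j : vertex I) :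
  m i j != 0 -> x i != x j -> lambda != m i j ->
  injective (mulmx (dconn m x lambda j i) : 'cV[H]_2 -> 'cV[H]_2).
Proof.
move=> m0 xij lm v w /eqP; rewrite -subr_eq0 -mulmxBr => /eqP.
move=> Du0; apply/eqP; rewrite -subr_eq0; move: (v - w) Du0 => u Du0.
pose s := dxd m x i j * (u 0 0 - x i * u 1 0).
have Du k : (dconn m x lambda j i *m u) k 0 =
    u k 0 + lambda *: (col2 (x j) 1 k 0 * s).
  rewrite mulmxDl mul1mx -scalemxAl !mxE !big_ord_recl big_ord0 addr0 !mxE.
  rewrite /= (_ : lift ord0 ord0 = 1); last exact: val_inj.
  by case: ifP => _ /=;
     rewrite mulr_algl /s mulrBr ?mul1r ?mulrBr !mulNr ?mulrA.
have u0 k : u k 0 = - (lambda *: (col2 (x j) 1 k 0 * s)).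
  by apply/eqP; rewrite -addr_eq0 -Du Du0 mxE.
have dxu : dx x i j \is a GRing.unit by rewrite quat_unitE subr_eq0.
have sE : s = (lambda / m i j) *: s.
  rewrite {1}/s !u0 !mxE /= mul1r mulrN opprK addrC -scalerAr -scalerBr.
  rewrite -mulrBl -/(dx x i j) /dxd -scalerAl -scalerAr mulKr //.
  by rewrite scalerA mulrC.
have s0 : s = 0.
  apply/eqP; have /eqP := sE; rewrite -subr_eq0 -{1}[s]scale1r -scalerBl.
  move=> /eqP/(congr1 ( *:%R (1 - lambda / m i j)^-1)).
  rewrite scaler0 scalerA mulVf ?scale1r => [->//|].
  rewrite subr_eq0 eq_sym; apply: contra_neq lm => lm.
  by rewrite -[lambda](divfK m0) lm mul1r.
by apply/eqP/matrixP => k l; rewrite ord1 u0 s0 mulr0 scaler0 oppr0 mxE.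
Qed.

End PolarisedCurve.

(* Main.v *)
Require Import Defs.
From mathcomp Require Import all_boot all_order all_algebra reals.
From mathcomp Require Import classical_sets.
Set Implicit Arguments.
Unset Strict Implicit.
Unset Printing Implicit Defensive.
Import Order.TTheory GRing.Theory Num.Theory.
Local Open Scope ring_scope.

(** Both conditions are required edge by edge, and on an oriented edge [(ij)]
    both say the same quaternionic equation. Applying the connection to the
    representative [(xhat_i, 1)] gives
      [(xhat_i + mu x_j s, 1 + mu s)] with [s = dx^d_ij (xhat_i - x_i)]
    ([dconn_affine]). The connection is injective because [mu <> m_ij], so it
    maps the line of [xhat_i] onto a line, and this line is the one of [xhat_j]
    as soon as the image vector lies in the latter ([proj_image_affineP]), that
    is, when its first coordinate is [xhat_j] times the second one:
      [xhat_j - xhat_i = mu (x_j - xhat_j) s].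
    Inserting [dx^d_ij = (x_i - x_j)^-1 / m_ij] and solving for the real number
    [mu / m_ij], which is central, turns this into the cross-ratio equation of
    a Darboux pair ([cross_ratio_eq]). *)

(** Moving [a], [c^-1] and [d^-1] across leaves [r] between [a^-1] and [d];
    being a scalar it is central and can be pulled out in front. *)
Lemma cross_ratio_eq (K : comNzRingType) (A : unitAlgType K) (a c y d : A)
    (r : K) :
    a \is a GRing.unit -> c \is a GRing.unit -> d \is a GRing.unit ->
  a * c^-1 * y * d^-1 = r%:A <-> y = r *: (c * a^-1 * d).
Proof.
move=> ua uc ud; split=> [E | ->].
  have -> : y = c * a^-1 * (a * c^-1 * y * d^-1) * d.
    by rewrite !mulrA !divrK // divrr // mul1r.
  by rewrite E -scalerAr mulr1 -scalerAl.
by rewrite -scalerAr -scalerAl !mulrA !mulrVK // divrr // mulrK.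
Qed.

Section ProjectiveLine.
Variable R : realType.
Local Notation H := (quat R).

Lemma col2_eq (a b c d : H) : col2 a b = col2 c d <-> a = c /\ b = d.
Proof.
split=> [/matrixP E | [-> ->] //].
by have := (E 0 0, E 1 0); rewrite !mxE /= => -[].
Qed.

Lemma col2_scale (a b q : H) : col2 a b *m q%:M = col2 (a * q) (b * q).
Proof.
apply/matrixP => k l; rewrite ord1 !mxE big_ord1 !mxE eqxx mulr1n.
by case: ifP.
Qed.

(** One inclusion between the two lines suffices: injectivity keeps the factor
    [b] from vanishing, hence makes it invertible. *)
Lemma proj_image_affineP (A : 'M[H]_2) (p q a b : H) :
    injective (mulmx A : 'cV[H]_2 -> 'cV[H]_2) ->
    A *m col2 p 1 = col2 a b ->
  proj_image A (affine_pt p) = affine_pt q <-> a = q * b.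
Proof.
move=> injA Ap; split=> [E | Eab].
  have : (affine_pt q : set _) (col2 a b).
    rewrite -E; exists (col2 p 1) => //; exists 1 => //.
    by rewrite col2_scale !mulr1.
  by move=> [c _]; rewrite col2_scale mul1r => /col2_eq[<- <-].
have b_unit : b \is a GRing.unit.
  rewrite quat_unitE; apply/eqP => b0; have /eqP[] := col2_neq0 p.
  apply: injA; rewrite mulmx0 Ap Eab b0 mulr0.
  by apply/matrixP => k l; rewrite !mxE if_same.
apply/seteqP; split=> w /=.
  move=> [_ [c _ <-] <-]; exists (b * c) => //.
  by rewrite mulmxA Ap !col2_scale Eab mul1r mulrA.
move=> [c _ <-]; exists (col2 p 1 *m (b^-1 * c)%:M).
  by exists (b^-1 * c).
by rewrite mulmxA Ap !col2_scale Eab mul1r !mulrA mulrK // mulrV // mul1r.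
Qed.

Lemma dconn_affine (I : interval int) (m : vertex I -> vertex I -> R)
    (x : vertex I -> H) (lambda : R) (i j : vertex I) (p : H) :
  let s := dxd m x i j * (p - x i) in
  dconn m x lambda j i *m col2 p 1
    = col2 (p + lambda *: (x j * s)) (1 + lambda *: s).
Proof.
move=> s; apply/matrixP => k l; rewrite ord1 mulmxDl mul1mx -scalemxAl.
rewrite !mxE !big_ord_recl big_ord0 addr0 !mxE /=.
by case: ifP => _; rewrite mulr1 mulr_algl /s !mulrBr ?mulrA.
Qed.

End ProjectiveLine.

Lemma polarisation_neq0 (R : realType) (I : interval int)
    (m : vertex I -> vertex I -> R) (i j : vertex I) :
  polarisation m -> edge i j -> m i j != 0.
Proof. by move=> [_ [mp | mn]] eij; [rewrite gt_eqF ?mp | rewrite lt_eqF ?mn]. Qed.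

Theorem theorem3p7 (R : realType) (I : interval int)
    (m : vertex I -> vertex I -> R) (x xhat : vertex I -> quat R) (mu : R)
    (m_pol : polarisation m)
    (x_edge : forall i j : vertex I, edge i j -> x i <> x j)
    (mu_edge : forall i j : vertex I, edge i j -> mu <> m i j)
    (xhat_x : forall i : vertex I, xhat i <> x i) :
  darboux_pair m mu x xhat <->
  proj_parallel m x mu (fun i => affine_pt (xhat i)).
Proof.
suff edgeP i j : edge i j ->
    (x i - x j) * (x j - xhat j)^-1 * (xhat j - xhat i) * (xhat i - x i)^-1
      = (mu / m i j)%:A
    <-> proj_image (dconn m x mu j i) (affine_pt (xhat i)) = affine_pt (xhat j).
  by split=> E i j eij; apply/edgeP => //; apply: E.
move=> eij.
have xij : x i != x j by apply/eqP/x_edge.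
have dconnI : injective (mulmx (dconn m x mu j i) : 'cV_2 -> 'cV_2).
  apply: dconn_inj => //; first exact: polarisation_neq0.
  exact/eqP/mu_edge.
have unitB (p q : quat R) : p != q -> p - q \is a GRing.unit.
  by rewrite quat_unitE subr_eq0.
rewrite (proj_image_affineP _ dconnI (dconn_affine _ _ _ _ _ _)).
rewrite cross_ratio_eq ?unitB //; last 2 first.
- by rewrite eq_sym; apply/eqP/xhat_x.
- exact/eqP/xhat_x.
set s := dxd m x i j * _.
have -> : (mu / m i j) *: ((x j - xhat j) * (x i - x j)^-1 * (xhat i - x i))
    = mu *: (x j * s) - mu *: (xhat j * s).
  rewrite -scalerBr -mulrBl -scalerA /s -[in RHS]scalerAl.
  by rewrite -[in RHS](scalerAr _ (x j - xhat j)) mulrA.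
rewrite mulrDr mulr1 -scalerAr; split=> [/eqP | E].
  by rewrite subr_eq addrC addrA eq_sym subr_eq => /eqP.
by apply/eqP; rewrite subr_eq addrC addrA E addrK.
Qed.
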